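(* Let $A$ be a complex abelian variety with a faithful action of a finite abelian group $G$, and let $W$ be an irreducible rational representation of $G$. Let $K \subseteq G$ be the subgroup associated to $W$, i.e. $K = \ker(\chi)$ for any complex irreducible character $\chi$ of $G$ that is Galois-associated to $W$, and let $$\mathcal{P}_K = \{ H \le G : K \subset H \text{ and } [H:K] \text{ is prime} \}.$$ Then the isotypical component $A_W$ of $A$ corresponding to $W$ is $$A_W = \begin{cases} \displaystyle\bigcap_{H \in \mathcal{P}_K} P(A^K/A^H) & \text{if } K \neq G, \\[2mm] A^G & \text{if } K = G. \end{cases}$$
   Context: Group actions on abelian varieties are by automorphisms (fixing $0$) and are assumed faithful. The action induces a homomorphism of $\mathbb{Q}$-algebras $\rho : \mathbb{Q}[G] \to \mathrm{End}_{\mathbb{Q}}(A) = \mathrm{End}(A) \otimes_{\mathbb{Z}} \mathbb{Q}$. For an idempotent $e \in \mathbb{Q}[G]$, $\mathrm{im}(e) \subseteq A$ denotes the abelian subvariety given by the image of $n\rho(e)$, where $n$ is any positive integer with $n\rho(e) \in \mathrm{End}(A)$; it does not depend on $n$. Isotypical component. The semisimple algebra $\mathbb{Q}[G]$ is a product of simple $\mathbb{Q}$-algebras $Q_1 \times \cdots \times Q_r$ with units the central idempotents $e_1, \dots, e_r$, corresponding bijectively to the irreducible rational representations $W_1, \dots, W_r$ of $G$. The isotypical component of $A$ corresponding to $W_i$ is $A_{W_i} := \mathrm{im}(e_i)$. Subgroups. For a subgroup $H \le G$ put $p_H := \frac{1}{|H|} \sum_{h \in H} h \in \mathbb{Q}[G]$,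 an idempotent, and $A^H := \mathrm{im}(p_H)$ (the maximal abelian subvariety of $A$ on which $H$ acts trivially). For subgroups $H \subset N$ of $G$, $p_H - p_N$ is an idempotent of $\mathbb{Q}[G]$, and one defines $P(A^H/A^N) := \mathrm{im}(p_H - p_N)$, the complementary abelian subvariety of $A^N$ in $A^H$. Galois-associated characters. For a complex irreducible character $\chi$ of the abelian group $G$ let $L_\chi = \mathbb{Q}(\chi(g) : g \in G)$, and for $\tau \in \mathrm{Gal}(L_\chi/\mathbb{Q})$ let $\chi^\tau(g) = \tau(\chi(g))$. Then $W = \bigoplus_{\tau \in \mathrm{Gal}(L_\chi/\mathbb{Q})} \chi^\tau$ is (the complexification of) an irreducible rational representation of $G$, every irreducible rational representation arises in this way, and one says that each $\chi^\tau$ and $W$ are Galois-associated. All characters Galois-associated to a given $W$ have the same kernel, so $K$ is well defined. *)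

(* Defs.v *)
From HB Require Import structures.
From mathcomp Require Import all_boot all_order all_algebra all_fingroup.
From mathcomp Require Import all_solvable all_field all_character.
From mathcomp Require Import sesquilinear.
From mathcomp Require Import boolp classical_sets reals.
From mathcomp Require Import complex ring.

Set Implicit Arguments.
Unset Strict Implicit.
Unset Printing Implicit Defensive.

Import Order.TTheory GRing.Theory Num.Theory.
Local Open Scope ring_scope.
Local Open Scope complex_scope.

(* A lattice in a complex vector space: the Z-span of an R-basis (dim_R V =
   2 dim_C V, so R-freeness of a family of that length suffices). *)
Definition is_lattice (R : realType) (V : vectType R[i]) (L : set V) : Prop :=
  exists b : 'I_(\dim {:V}).*2 -> V,
    (forall c : 'I_(\dim {:V}).*2 -> R,
       \sum_k (c k)%:C *: b k = 0 -> forall k, c k = 0) /\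
    (forall v, L v <->
       exists z : 'I_(\dim {:V}).*2 -> int, v = \sum_k b k *~ z k).

(* Riemann's condition: a positive definite hermitian form whose imaginary part
   is integral on the lattice. *)
Definition is_polarization (R : realType) (V : vectType R[i]) (L : set V)
    (h : {dot V for @conjc R}) : Prop :=
  forall u v, L u -> L v -> complex.Im (h u v) \is a Num.int.

(* A complex abelian variety, given analytically: a group uniformized by its
   Lie algebra, av_exp : Lie(A) ->> A, whose period lattice ker(av_exp) admits a
   polarization; that is, A = V / L with V / L a polarizable complex torus. *)
Record abelian_variety (R : realType) := AbelianVariety {
  av_sort :> zmodType;
  av_lie : vectType R[i];
  av_exp : {additive av_lie -> av_sort};
  av_exp_surj : forall a, exists v, av_exp v = a;
  av_lattice : is_lattice [set v | av_exp v = 0]%classic;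
  av_polarized : exists h, @is_polarization R av_lie
                             [set v | av_exp v = 0]%classic h
}.

(* Endomorphisms of A as an abelian variety (fixing 0) are the maps induced by
   the C-linear endomorphisms of Lie(A) preserving the period lattice. *)
Definition is_endo (R : realType) (A : abelian_variety R) (f : A -> A) : Prop :=
  exists F : 'End(av_lie A), forall v, f (av_exp A v) = av_exp A (F v).

Section GroupAction.

Variables (R : realType) (A : abelian_variety R).
Variables (gT : finGroupType) (G : {group gT}) (act : gT -> A -> A).

(* Only the values of act on G matter. *)
Definition acts_by_automorphisms : Prop :=
  [/\ forall g, g \in G -> is_endo (act g),
      forall a, act 1%g a = a
    & forall g h a, g \in G -> h \in G -> act (g * h)%g a = act g (act h a)].

Definition acts_faithfully : Prop :=
  forall g, g \in G -> (forall a, act g a = a) -> g = 1%g.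

(* Q[G] is the algebra group_ring rat G of matrices spanned by regular_repr rat
   G g, for g in G; the coordinates of e in that basis are those of its row
   at 1. *)
Definition gcoef (e : 'M[rat]_#|G|) (g : gT) : rat :=
  gring_row e 0 (gring_index G g).

(* f = n rho(e) in End(A) (x) Q. As End(A) is torsion-free, f (x) 1 =
   sum_g act g (x) n e_g means that m f = sum_g (m n e_g) act g in End(A) for a
   (equivalently, any) m > 0 such that all the m n e_g are integers. *)
Definition is_mul_rho (n : nat) (e : 'M[rat]_#|G|) (f : A -> A) : Prop :=
  exists (m : nat) (z : gT -> int),
    [/\ (0 < m)%N,
        forall g, g \in G -> (z g)%:~R = (m * n)%N%:R * gcoef e g
      & forall a, f a *+ m = \sum_(g in G) act g a *~ z g].

(* im(e), the image of n rho(e) for any n > 0 such that n rho(e) is in End(A);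
   such an n exists (mul_rho_exists) and the image does not depend on it
   (eim_eq). *)
Definition eim (e : 'M[rat]_#|G|) : set A :=
  [set b | exists (n : nat) (f : A -> A),
    [/\ (0 < n)%N, is_endo f, is_mul_rho n e f & range f b]]%classic.

Definition subgroup_idem (H : {set gT}) : 'M[rat]_#|G| :=
  #|H|%:R^-1 *: gset_mx rat G H.

(* A^H *)
Definition av_fix (H : {set gT}) : set A := eim (subgroup_idem H).

(* P(A^H / A^N), for H a subgroup of N *)
Definition av_compl (H N : {set gT}) : set A :=
  eim (subgroup_idem H - subgroup_idem N).

End GroupAction.

(* The socle of the regular representation over Q, which indexes the simple
   factors of Q[G]; socle_exists only provides it in the classical monad. *)
Lemma rat_irr_inhabited (gT : finGroupType) (G : {group gT}) :
  inhabited (irrType rat G).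
Proof.
apply: contrapT => noirr.
suff: is_true false by [].
by apply: (socle_exists (regular_repr rat G)) => sG; case: noirr; exists.
Qed.

Definition rat_irr (gT : finGroupType) (G : {group gT}) : irrType rat G :=
  sval (cid (let: inhabits s := rat_irr_inhabited G in
             ex_intro (fun=> True) s I)).

(* The unit of the simple factor of Q[G] corresponding to W. Wedderburn_id (_) is
   an element of Q[G] that does not depend on the choice made in rat_irr. *)
Definition isotypical_idem (gT : finGroupType) (G : {group gT}) (n : nat)
    (W : mx_representation rat G n) : 'M[rat]_#|G| :=
  Wedderburn_id (irr_comp (rat_irr G) W).

Definition isotypical_component (R : realType) (A : abelian_variety R)
    (gT : finGroupType) (G : {group gT}) (act : gT -> A -> A) (n : nat)
    (W : mx_representation rat G n) : set A :=
  eim act (isotypical_idem W).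

(* 'chi_j is one of the chi^tau, tau in Gal(L_chi / Q), for chi = 'chi_i:
   Gal(L_chi / Q) consists of the restrictions to L_chi of the automorphisms of
   the field algC of algebraic numbers. *)
Definition galois_conj (gT : finGroupType) (G : {group gT}) (i j : Iirr G) :
    Prop :=
  exists tau : {rmorphism algC -> algC}, 'chi_j = cfAut tau 'chi_i.

(* 'chi_i is Galois-associated to W: the complexification of W is the sum of
   the chi^tau, which are pairwise distinct as tau ranges over
   Gal(L_chi / Q). *)
Definition galois_associated (gT : finGroupType) (G : {group gT}) (n : nat)
    (W : mx_representation rat G n) (i : Iirr G) : Prop :=
  cfRepr (map_repr (@ratr algC) W) = \sum_(j | `[< galois_conj i j >]) 'chi_j.

(* P_K *)
Definition prime_overgroups (gT : finGroupType) (G K : {group gT}) :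
    set {group gT} :=
  [set H : {group gT} |
    [/\ H \subset G, K \subset H & prime #|H : K|%g]]%classic.

Section IdempotentImage.

Variables (R : realType) (A : abelian_variety R).

Lemma is_endoMn (f : A -> A) a k : is_endo f -> f (a *+ k) = f a *+ k.
Proof.
case=> F hF; have [v <-] := av_exp_surj a.
by rewrite -raddfMn !hF !raddfMn.
Qed.

Lemma av_divisible (a : A) k : (0 < k)%N -> exists b, a = b *+ k.
Proof.
move=> k0; have [v <-] := av_exp_surj a.
exists (av_exp A (k%:R^-1 *: v)); rewrite -raddfMn -scaler_nat scalerA divff.
  by rewrite scale1r.
by rewrite pnatr_eq0 -lt0n.
Qed.

Lemma range_endoMn (f : A -> A) k : (0 < k)%N -> is_endo f ->
  range f = range (fun a => f a *+ k).
Proof.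
move=> k0 hf; apply/seteqP; split=> _ [a _ <-].
  by have [b ->] := av_divisible a k0; exists b; rewrite // is_endoMn.
by exists (a *+ k); rewrite // is_endoMn.
Qed.

Variables (gT : finGroupType) (G : {group gT}) (act : gT -> A -> A).

Lemma range_mul_rho (e : 'M[rat]_#|G|) n n' f f' :
    (0 < n)%N -> (0 < n')%N -> is_endo f -> is_endo f' ->
    is_mul_rho act n e f -> is_mul_rho act n' e f' -> range f = range f'.
Proof.
move=> n0 n0' hf hf' [m [z [m0 hz fz]]] [m' [z' [m0' hz' fz']]].
rewrite (@range_endoMn f (m * (m' * n'))) ?muln_gt0 ?m0 ?m0' //.
rewrite (@range_endoMn f' (m' * (m * n))) ?muln_gt0 ?m0 ?m0' //.
suff ->: (fun a => f a *+ (m * (m' * n'))) = (fun a => f' a *+ (m' * (m * n))).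
  by [].
apply: funext => a.
rewrite !mulrnA fz fz' -!mulrnA -!sumrMnl; apply: eq_bigr => g gG.
rewrite !pmulrn -!mulrzA; congr (_ *~ _).
apply: (@intr_inj rat); rewrite !intrM hz // hz' // !natrM.
by rewrite -!pmulrn; ring.
Qed.

Lemma eim_eq (e : 'M[rat]_#|G|) n f :
    (0 < n)%N -> is_endo f -> is_mul_rho act n e f -> eim act e = range f.
Proof.
move=> n0 hf ef; apply/seteqP; split=> [b [n' [f' [n0' hf' ef']]]|b hb].
  by rewrite (range_mul_rho n0' n0 hf' hf ef' ef).
by exists n, f.
Qed.

Lemma mul_rho_exists (e : 'M[rat]_#|G|) : acts_by_automorphisms G act ->
  exists n f, [/\ (0 < n)%N, is_endo f & is_mul_rho act n e f].
Proof.
case=> endo _ _.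
have /choice[F hF] : forall g, exists F : 'End(av_lie A),
    g \in G -> forall v, act g (av_exp A v) = av_exp A (F v).
  move=> g; have [/endo[F hF]|_] := boolP (g \in G); first by exists F.
  by exists 0.
pose d g := `|denq (gcoef e g)|%N; pose n := (\prod_(g in G) d g)%N.
pose z g := (numq (gcoef e g) * (n %/ d g)%N%:Z)%R.
exists n, (fun a => \sum_(g in G) act g a *~ z g); split.
- by rewrite prodn_cond_gt0 // => g _; rewrite /d absz_gt0 denq_neq0.
- exists (\sum_(g in G) F g *~ z g) => v.
  rewrite sum_lfunE raddf_sum; apply: eq_bigr => g gG.
  by rewrite hF // -raddfMz -[F g *~ _]scaler_int scale_lfunE scaler_int.
- exists 1%N, z; split=> // g gG; rewrite mul1n /z intrM.
  have dn : (d g %| n)%N by rewrite /n (bigD1 g) //= dvdn_mulr.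
  rewrite -[in RHS](divnK dn) natrM -[in RHS](divq_num_den (gcoef e g)).
  have -> : (d g)%:R = (denq (gcoef e g))%:~R :> rat.
    by rewrite /d pmulrn; congr (_%:~R); rewrite gez0_abs.
  rewrite mulrC -[RHS]mulrA [X in _ = _ * X]mulrC divfK ?pmulrn //.
  by rewrite intr_eq0 denq_neq0.
Qed.

End IdempotentImage.

(* Main.v *)
(* Elements of Q[G] are determined by their values at the characters of G. Under
   chi_j, p_H takes the value 1 if H <= ker chi_j and 0 otherwise, while e_W takes
   the value 1 exactly when chi_j is Galois-conjugate to chi_i, that is, since
   G / K is cyclic, when ker chi_j = K. Hence e_W = p_K prod_(H in P_K) (1 - p_H),
   where p_H may be replaced by p_S for S the Sylow [H : K]-subgroup of H. As G / K
   is cyclic, the [H : K] are distinct primes, so that the factors 1 - p_S have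
   pairwise coprime denominators; this is what makes the image of the product the
   whole intersection of the images, and not just its neutral component. *)

From HB Require Import structures.
Require Import Defs.
From mathcomp Require Import all_boot all_order all_algebra all_fingroup.
From mathcomp Require Import all_solvable all_field all_character.
From mathcomp Require Import boolp classical_sets reals.
From mathcomp Require Import complex.

Import GRing.Theory.
Local Open Scope ring_scope.

(** * The group ring Q[G] and the values of its elements at characters *)

Section GroupRing.

Set Implicit Arguments.
Unset Strict Implicit.
Variables (gT : finGroupType) (G : {group gT}).

Local Notation aG := (regular_repr rat G).
Local Notation R_G := (group_ring rat G).

Lemma gcoefE (e : 'M[rat]_#|G|) g :
  gcoef e g = e (gring_index G 1%g) (gring_index G g).
Proof. by rewrite /gcoef /gring_row mxE. Qed.

Lemma gcoefD (e e' : 'M[rat]_#|G|) g : gcoef (e + e') g = gcoef e g + gcoef e' g.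
Proof. by rewrite !gcoefE !mxE. Qed.

Lemma gcoefN (e : 'M[rat]_#|G|) g : gcoef (- e) g = - gcoef e g.
Proof. by rewrite !gcoefE !mxE. Qed.

Lemma gcoefZ c (e : 'M[rat]_#|G|) g : gcoef (c *: e) g = c * gcoef e g.
Proof. by rewrite !gcoefE !mxE. Qed.

Lemma gcoef_sum I r (P : pred I) (F : I -> 'M[rat]_#|G|) g :
  gcoef (\sum_(x <- r | P x) F x) g = \sum_(x <- r | P x) gcoef (F x) g.
Proof. by rewrite gcoefE summxE; apply: eq_bigr => x _; rewrite gcoefE. Qed.

Lemma gcoef_regular : {in G &, forall h g, gcoef (aG h) g = (h == g)%:R}.
Proof.
move=> h g Gh Gg; rewrite gcoefE /= !mxE /= gring_indexK // mul1g.
by rewrite (inj_in_eq (can_in_inj (@gring_indexK _ G))) // eq_sym.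
Qed.

Lemma gring_expand (e : 'M[rat]_#|G|) :
  (e \in R_G)%MS -> e = \sum_(g in G) gcoef e g *: aG g.
Proof.
case/envelop_mxP=> a def_e; rewrite {1}def_e; apply: eq_bigr => g Gg.
congr (_ *: _); rewrite def_e gcoef_sum (bigD1 g) //= gcoefZ gcoef_regular //.
rewrite eqxx mulr1 big1 ?addr0 // => h /andP[Gh neq_hg].
by rewrite gcoefZ gcoef_regular // (negPf neq_hg) mulr0.
Qed.

Lemma gcoef_inj (e e' : 'M[rat]_#|G|) : (e \in R_G)%MS -> (e' \in R_G)%MS ->
  {in G, gcoef e =1 gcoef e'} -> e = e'.
Proof.
move=> Re Re' eq_ee'; rewrite (gring_expand Re) (gring_expand Re').
by apply: eq_bigr => g Gg; rewrite eq_ee'.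
Qed.

Lemma gcoefM (e e' : 'M[rat]_#|G|) k : (e \in R_G)%MS -> (e' \in R_G)%MS ->
  k \in G ->
  gcoef (e *m e') k = \sum_(g in G) gcoef e g * gcoef e' (g^-1 * k)%g.
Proof.
move=> Re Re' Gk; rewrite {1}(gring_expand Re) mulmx_suml gcoef_sum.
apply: eq_bigr => g Gg; rewrite -scalemxAl gcoefZ; congr (_ * _).
rewrite {1}(gring_expand Re') mulmx_sumr gcoef_sum.
have Ggk : (g^-1 * k)%g \in G by rewrite groupM ?groupV.
rewrite (bigD1 _ Ggk) /= -scalemxAr gcoefZ -repr_mxM //.
rewrite gcoef_regular ?groupM // ?groupV // mulKVg eqxx mulr1 big1 ?addr0 //.
move=> h /andP[Gh neq_h]; rewrite -scalemxAr gcoefZ -repr_mxM //.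
rewrite gcoef_regular ?groupM // -(inj_eq (mulgI g^-1%g)) mulKg.
by rewrite (negPf neq_h) mulr0.
Qed.

Lemma group_ring_mul (e e' : 'M[rat]_#|G|) :
  (e \in R_G)%MS -> (e' \in R_G)%MS -> (e *m e' \in R_G)%MS.
Proof. exact: envelop_mxM. Qed.

Lemma group_ring1 : (1%:M \in R_G)%MS.
Proof. exact: envelop_mx1. Qed.

Lemma group_ringB (e e' : 'M[rat]_#|G|) :
  (e \in R_G)%MS -> (e' \in R_G)%MS -> (e - e' \in R_G)%MS.
Proof. by move=> Re Re'; rewrite linearB /= addmx_sub // eqmx_opp. Qed.

Lemma gset_mx_group_ring (H : {set gT}) :
  H \subset G -> (gset_mx rat G H \in R_G)%MS.
Proof.
move=> sHG; rewrite linear_sum summx_sub // => h Hh.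
by rewrite envelop_mx_id // (fintype.subsetP sHG).
Qed.

Lemma subgroup_idem_group_ring (H : {set gT}) :
  H \subset G -> (subgroup_idem G H \in R_G)%MS.
Proof. by move=> sHG; rewrite linearZ scalemx_sub ?gset_mx_group_ring. Qed.

Lemma gcoef_gset (H : {set gT}) g : H \subset G -> g \in G ->
  gcoef (gset_mx rat G H) g = (g \in H)%:R.
Proof.
move=> sHG Gg; rewrite gcoef_sum.
rewrite (eq_bigr (fun h => (h == g)%:R)) => [|h Hh]; last first.
  by rewrite gcoef_regular // (fintype.subsetP sHG).
case: (boolP (g \in H)) => Hg.
  rewrite (bigD1 g) //= eqxx big1 ?addr0 // => h /andP[_ neq].
  by rewrite (negPf neq).
by rewrite big1 // => h Hh; case: eqP Hh Hg => // -> ->.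
Qed.

Lemma gcoef1 g : g \in G -> gcoef (1%:M : 'M[rat]_#|G|) g = (g == 1%g)%:R.
Proof. by move=> Gg; rewrite -(repr_mx1 aG) gcoef_regular // eq_sym. Qed.

(** The linear extension of ['chi_j] to Q[G]; for abelian G these maps are the components of the
    Fourier transform. *)
Definition gchar (j : Iirr G) (e : 'M[rat]_#|G|) : algC :=
  \sum_(g in G) ratr (gcoef e g) * 'chi_j g.

Lemma gcharB j e e' : gchar j (e - e') = gchar j e - gchar j e'.
Proof.
rewrite -sumrB; apply: eq_bigr => g _.
by rewrite gcoefD gcoefN rmorphB mulrBl.
Qed.

Lemma gchar_aut (tau : {rmorphism algC -> algC}) (i j : Iirr G) e :
  'chi_j = cfAut tau 'chi_i -> gchar j e = tau (gchar i e).
Proof.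
move=> chi_j; rewrite rmorph_sum; apply: eq_bigr => g _.
by rewrite chi_j cfunE rmorphM fmorph_rat.
Qed.

(** Links W to the characters of G: by linearity it is enough to compare traces at group elements.
    It serves to exclude that certain idempotents act on W as 0. *)
Lemma ratr_trace_gring_op n (W : mx_representation rat G n)
    (P : pred (Iirr G)) (e : 'M[rat]_#|G|) :
  cfRepr (map_repr (@ratr algC) W) = \sum_(j | P j) 'chi_j -> (e \in R_G)%MS ->
  ratr (\tr (gring_op W e)) = \sum_(j | P j) gchar j e.
Proof.
move=> chiW Re; rewrite {1}(gring_expand Re) !linear_sum rmorph_sum /=.
rewrite exchange_big; apply: eq_bigr => g Gg.
rewrite -mulr_sumr -sum_cfunE -chiW cfunE Gg mulr1n !linearZ /=.
by rewrite rmorphM gring_opG // map_reprE trace_map_mx.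
Qed.

Hypothesis abG : abelian G.

Lemma irr_lin (j : Iirr G) : 'chi_j \is a linear_char.
Proof. exact/char_abelianP. Qed.

Lemma gcharM j e e' : (e \in R_G)%MS -> (e' \in R_G)%MS ->
  gchar j (e *m e') = gchar j e * gchar j e'.
Proof.
move=> Re Re'; rewrite mulr_suml.
transitivity (\sum_(k in G) \sum_(g in G)
    ratr (gcoef e g * gcoef e' (g^-1 * k)%g) * 'chi_j k).
  by apply: eq_bigr => k Gk; rewrite gcoefM // rmorph_sum mulr_suml.
rewrite exchange_big; apply: eq_bigr => g Gg /=.
(* Substituting k = g h separates the convolution into a product of two sums. *)
rewrite (reindex_inj (mulgI g)) /= mulr_sumr.
apply: eq_big => h; first by rewrite groupMl.
rewrite groupMl // => Gh; rewrite mulKg (lin_charM (irr_lin j)) //.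
by rewrite rmorphM mulrACA.
Qed.

Lemma gchar_idem j e : (e \in R_G)%MS -> e *m e = e ->
  gchar j e = 0 \/ gchar j e = 1.
Proof.
move=> Re ee; have /eqP := gcharM j Re Re; rewrite ee eq_sym -subr_eq0.
rewrite -{3}[gchar j e]mulr1 -mulrBr mulf_eq0 subr_eq0.
by case/orP => /eqP; [left | right].
Qed.

(** Fourier inversion: column orthogonality recovers the coefficient at h, up to the factor
    |C_G(h)|. Identities in Q[G] can thus be checked one character at a time. *)
Lemma gchar_inj e e' : (e \in R_G)%MS -> (e' \in R_G)%MS ->
  (forall j, gchar j e = gchar j e') -> e = e'.
Proof.
have inversion f h : h \in G ->
    \sum_j gchar j f * ('chi_j h)^* = ratr (gcoef f h) * #|'C_G[h]%g|%:R.
  move=> Gh; transitivity (\sum_(g in G) ratr (gcoef f g) *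
      \sum_(j : Iirr G) 'chi_j g * ('chi_j h)^*).
    under eq_bigr do rewrite mulr_suml.
    rewrite exchange_big; apply: eq_bigr => g _; rewrite mulr_sumr.
    by apply: eq_bigr => j _; rewrite mulrA.
  rewrite (bigD1 h) //= second_orthogonality_relation // class_refl.
  rewrite big1 ?addr0 ?second_orthogonality_relation ?class_refl //.
  move=> g /andP[Gg neq_gh]; rewrite second_orthogonality_relation //.
  have -> : (h ^: G = [set h])%g.
    apply/finset.setP=> x; rewrite inE; apply/imsetP/eqP => [[y Gy ->] | ->].
      by rewrite conjgE (centsP abG h Gh y Gy) mulKg.
    by exists 1%g; rewrite ?conjg1.
  by rewrite inE (negPf neq_gh) mulr0.
move=> Re Re' eq_ee'; apply: gcoef_inj => // h Gh.
apply: (fmorph_inj (@ratr algC)); apply: (mulIf (neq0CG 'C_G[h])).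
by rewrite -!inversion //; apply: eq_bigr => j _; rewrite eq_ee'.
Qed.

Lemma gringC e e' : (e \in R_G)%MS -> (e' \in R_G)%MS -> e *m e' = e' *m e.
Proof.
move=> Re Re'; apply: gchar_inj; rewrite ?group_ring_mul // => j.
by rewrite !gcharM // mulrC.
Qed.

Lemma gchar1 j : gchar j 1%:M = 1.
Proof.
rewrite /gchar (bigD1 1%g) //= gcoef1 // eqxx rmorph1 mul1r.
rewrite lin_char1 ?irr_lin // big1 ?addr0 // => g /andP[Gg /negPf neq].
by rewrite gcoef1 // neq rmorph0 mul0r.
Qed.

Lemma gchar_subgroup_idem j (H : {group gT}) : H \subset G ->
  gchar j (subgroup_idem G H) = (H \subset cfker 'chi_j)%:R.
Proof.
move=> sHG; have chi_lin := irr_lin j.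
have -> : gchar j (subgroup_idem G H) = #|H|%:R^-1 * \sum_(h in H) 'chi_j h.
  rewrite mulr_sumr /gchar (big_setID H) /= (finset.setIidPr sHG) [X in _ + X]big1 ?addr0.
    apply: eq_bigr => h Hh; have Gh := fintype.subsetP sHG h Hh.
    by rewrite gcoefZ gcoef_gset // Hh mulr1 fmorphV rmorph_nat.
  move=> h /finset.setDP[Gh /negPf nHh].
  by rewrite gcoefZ gcoef_gset // nHh mulr0 rmorph0 mul0r.
have kerE h : h \in G -> (h \in cfker 'chi_j) = ('chi_j h == 1).
  by move=> Gh; rewrite cfkerEirr inE (lin_char1 chi_lin).
have [sHK | /fintype.subsetPn[h0 Hh0]] := boolP (H \subset _).
  rewrite (eq_bigr (fun=> 1)) => [|h Hh]; first by rewrite sumr_const mulVf ?neq0CG.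
  by apply/eqP; rewrite -kerE ?(fintype.subsetP sHK) ?(fintype.subsetP sHG).
have Gh0 := fintype.subsetP sHG h0 Hh0; rewrite kerE // => chi_h0.
(* Translation by [h0] permutes H, and ['chi_j h0] differs from 1, so the sum must vanish. *)
have : 'chi_j h0 * (\sum_(h in H) 'chi_j h) = \sum_(h in H) 'chi_j h.
  rewrite mulr_sumr [RHS](reindex_inj (mulgI h0)) /=.
  apply: eq_big => h; first by rewrite groupMl.
  by move=> Hh; rewrite lin_charM // (fintype.subsetP sHG).
move/eqP; rewrite -subr_eq0 -{2}[\sum_(h in H) _]mul1r -mulrBl mulf_eq0.
by rewrite subr_eq0 (negPf chi_h0) => /eqP->; rewrite mulr0.
Qed.

End GroupRing.

(** * The action of Z[G] on A, and intersections of images *)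

Section GringAction.

Set Implicit Arguments.
Unset Strict Implicit.
Variables (R : realType) (A : abelian_variety R).
Variables (gT : finGroupType) (G : {group gT}) (act : gT -> A -> A).
Hypotheses (abG : abelian G) (actG : acts_by_automorphisms G act).

Local Notation R_G := (group_ring rat G).

(** The subring Z[G] of Q[G], whose elements give actual endomorphisms of A. *)
Definition gintegral (e : 'M[rat]_#|G|) : Prop :=
  (e \in R_G)%MS /\ {in G, forall g, gcoef e g \is a Num.int}.

(** [numq] reads an integral coefficient as an integer; outside Z[G] denominators are dropped, so
    that the map is total but no longer multiplicative in e. *)
Definition act_gring (e : 'M[rat]_#|G|) (a : A) : A :=
  \sum_(g in G) act g a *~ numq (gcoef e g).

Lemma gintegralM e e' : gintegral e -> gintegral e' -> gintegral (e *m e').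
Proof.
case=> Re Ze [Re' Ze']; split=> [|k Gk]; first exact: group_ring_mul.
rewrite gcoefM // rpred_sum // => g Gg.
by rewrite rpredM ?Ze ?Ze' // groupM ?groupV.
Qed.

Lemma gintegralMn k e : gintegral e -> gintegral (k%:R *: e).
Proof.
case=> Re Ze; split=> [|g Gg]; first by rewrite linearZ scalemx_sub.
by rewrite gcoefZ rpredM ?rpred_nat ?Ze.
Qed.

Lemma gintegralB e e' : gintegral e -> gintegral e' -> gintegral (e - e').
Proof.
case=> Re Ze [Re' Ze']; split=> [|g Gg]; first exact: group_ringB.
by rewrite gcoefD gcoefN rpredB ?Ze ?Ze'.
Qed.

Lemma gintegral_gset (H : {set gT}) : H \subset G -> gintegral (gset_mx rat G H).
Proof.
move=> sHG; split=> [|g Gg]; first exact: gset_mx_group_ring.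
by rewrite gcoef_gset.
Qed.

Lemma gintegral1 : gintegral 1%:M.
Proof.
by split=> [|g Gg]; [exact: group_ring1 | rewrite gcoef1].
Qed.

Lemma numq_intr (q : rat) : q \is a Num.int -> (numq q)%:~R = q.
Proof. by case/Num.Theory.intrP=> z ->; rewrite numq_int. Qed.

Lemma act_is_zmod_morphism g : g \in G -> zmod_morphism (act g).
Proof.
case: actG => endo _ _ /endo[F hF] a b.
have [u <-] := av_exp_surj a; have [v <-] := av_exp_surj b.
by rewrite -raddfB !hF !raddfB.
Qed.

Lemma act_sum g I r (P : pred I) (f : I -> A) : g \in G ->
  act g (\sum_(x <- r | P x) f x) = \sum_(x <- r | P x) act g (f x).
Proof.
move=> Gg.
(* Additivity of [act g] depends on g being in G, so the structure is packed locally. *)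
pose actg := HB.pack_for (GRing.Additive.type A A) (act g)
  (GRing.isZmodMorphism.Build A A (act g) (act_is_zmod_morphism Gg)).
exact: (raddf_sum actg).
Qed.

Lemma actMz g a z : g \in G -> act g (a *~ z) = act g a *~ z.
Proof.
move=> Gg.
pose actg := HB.pack_for (GRing.Additive.type A A) (act g)
  (GRing.isZmodMorphism.Build A A (act g) (act_is_zmod_morphism Gg)).
exact: (raddfMz actg).
Qed.

Lemma act_gring_is_zmod_morphism e : zmod_morphism (act_gring e).
Proof.
move=> a b; rewrite /act_gring -sumrB; apply: eq_bigr => g Gg.
by rewrite act_is_zmod_morphism // mulrzBl.
Qed.

HB.instance Definition _ e :=
  GRing.isZmodMorphism.Build A A (act_gring e) (act_gring_is_zmod_morphism e).

Lemma act_gring_endo e : is_endo (act_gring e).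
Proof.
have [endo _ _] := actG.
have /choice[F hF] : forall g, exists F : 'End(av_lie A),
    g \in G -> forall v, act g (av_exp A v) = av_exp A (F v).
  move=> g; have [/endo[F hF]|_] := boolP (g \in G); first by exists F.
  (* Nothing is asked of the lift outside G; 0 is a default. *)
  by exists 0.
exists (\sum_(g in G) F g *~ numq (gcoef e g)) => v.
rewrite sum_lfunE raddf_sum; apply: eq_bigr => g Gg.
by rewrite hF // -raddfMz -[F g *~ _]scaler_int scale_lfunE scaler_int.
Qed.

Lemma eim_act_gring n e : (0 < n)%N -> gintegral (n%:R *: e) ->
  eim act e = range (act_gring (n%:R *: e)).
Proof.
move=> n_gt0 [_ Zne]; apply: (eim_eq n_gt0 (act_gring_endo _)).
exists 1%N, (fun g => numq (gcoef (n%:R *: e) g)); split=> // g Gg.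
by rewrite mul1n numq_intr ?Zne // gcoefZ.
Qed.

Lemma act_gringZ k e a :
  gintegral e -> act_gring (k%:R *: e) a = act_gring e a *+ k.
Proof.
case=> _ Ze; rewrite -sumrMnl; apply: eq_bigr => g Gg.
rewrite [RHS]pmulrn -mulrzA; congr (_ *~ _); apply: (@intr_inj rat).
have Zge := Ze g Gg.
by rewrite intrM numq_intr ?gcoefZ ?rpredM ?rpred_nat // numq_intr // mulrC.
Qed.

Lemma act_gringM e e' a : gintegral e -> gintegral e' ->
  act_gring (e *m e') a = act_gring e (act_gring e' a).
Proof.
move=> [Re Ze] [Re' Ze']; have [_ _ actM] := actG.
transitivity (\sum_(k in G) \sum_(g in G)
    act k a *~ (numq (gcoef e g) * numq (gcoef e' (g^-1 * k)%g))).
  apply: eq_bigr => k Gk; rewrite -mulrz_sumr; congr (_ *~ _).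
  apply: (@intr_inj rat); rewrite numq_intr; last first.
    by have [_] := gintegralM (conj Re Ze) (conj Re' Ze'); apply.
  rewrite gcoefM // rmorph_sum; apply: eq_bigr => g Gg /=.
  by rewrite intrM !numq_intr ?Ze ?Ze' // groupM ?groupV.
rewrite exchange_big; apply: eq_bigr => g Gg.
rewrite act_sum // mulrz_suml (reindex_inj (mulgI g)) /=.
apply: eq_big => h; first by rewrite groupMl.
rewrite groupMl // => Gh; rewrite mulKg actM // actMz // -!mulrzA.
by congr (_ *~ _); rewrite mulrC.
Qed.

(* If x = q e b = q e' b', then n x and n' x lie in the image of q e e' because
   n e and n' e' act on x as n and n'; coprimality of n and n' then gives x. In
   general the left side is only the neutral component of the right side. *)
Lemma eim_inter q e e' m n n' :
    (0 < m)%N -> (0 < n)%N -> (0 < n')%N -> coprime n n' ->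
    e *m e = e -> e' *m e' = e' ->
    gintegral (m%:R *: q) -> gintegral (n%:R *: e) -> gintegral (n'%:R *: e') ->
  eim act (q *m e *m e') = (eim act (q *m e) `&` eim act (q *m e'))%classic.
Proof.
move=> m0 n0 n0' co_nn' ee ee' Zq Ze Ze'.
set Q := m%:R *: q in Zq; set E := n%:R *: e in Ze; set E' := n'%:R *: e' in Ze'.
have [RQ _] := Zq; have [RE _] := Ze; have [RE' _] := Ze'.
have EE : E *m E = n%:R *: E by rewrite -scalemxAl -scalemxAr ee.
have EE' : E' *m E' = n'%:R *: E' by rewrite -scalemxAl -scalemxAr ee'.
have def_QE : (m * n)%N%:R *: (q *m e) = Q *m E.
  by rewrite natrM -scalemxAl -scalemxAr scalerA.
have def_QE' : (m * n')%N%:R *: (q *m e') = Q *m E'.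
  by rewrite natrM -scalemxAl -scalemxAr scalerA.
have def_QEE' : (m * n * n')%N%:R *: (q *m e *m e') = Q *m E *m E'.
  by rewrite natrM -scalerA -[E']/(n'%:R *: e') -def_QE -!scalemxAl -!scalemxAr
    !scalerA mulrC.
clearbody Q E E'.
have ZQE : gintegral (Q *m E) by exact: gintegralM.
have ZQE' : gintegral (Q *m E') by exact: gintegralM.
have ZQEE' : gintegral (Q *m E *m E') by exact: gintegralM.
rewrite (@eim_act_gring (m * n * n')) ?muln_gt0 ?m0 ?n0 ?def_QEE' //.
rewrite (@eim_act_gring (m * n)) ?muln_gt0 ?m0 ?n0 ?def_QE //.
rewrite (@eim_act_gring (m * n')) ?muln_gt0 ?m0 ?n0' ?def_QE' //.
have QEE'C : Q *m E *m E' = Q *m E' *m E by rewrite -!mulmxA (gringC abG RE RE').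
apply/seteqP; split=> [_ [c _ <-] | x [[b _ def_x] [b' _ def_x']]].
  split; last by rewrite QEE'C act_gringM //; exists (act_gring E c).
  by rewrite act_gringM //; exists (act_gring E' c).
have xn' : x *+ n' = act_gring (Q *m E *m E') b.
  transitivity (act_gring E' x).
    rewrite -def_x' -act_gringM // (gringC abG RE' (group_ring_mul RQ RE')) //.
    by rewrite -mulmxA EE' -scalemxAr act_gringZ.
  by rewrite -def_x -act_gringM // (gringC abG RE' (group_ring_mul RQ RE)).
have xn : x *+ n = act_gring (Q *m E *m E') b'.
  transitivity (act_gring E x).
    rewrite -def_x -act_gringM // (gringC abG RE (group_ring_mul RQ RE)) //.
    by rewrite -mulmxA EE -scalemxAr act_gringZ.
  rewrite -def_x' -act_gringM // (gringC abG RE (group_ring_mul RQ RE')) //.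
  by rewrite QEE'C.
(* With u n + v n' = 1, the point x = u (n x) + v (n' x) is the image of u b' + v b. *)
have /coprimezP[[u v] /= uv] : coprimez n n' by [].
exists (b' *~ u + b *~ v) => //.
rewrite raddfD !raddfMz /= -xn -xn' !pmulrn -!mulrzA -mulrzDr.
by rewrite mulrC [n'%:Z * v]mulrC uv.
Qed.

End GringAction.

(** * Kernels of characters and their overgroups of prime index *)

Section CharacterKernel.

Set Implicit Arguments.
Unset Strict Implicit.
Variables (gT : finGroupType) (G : {group gT}).
Hypothesis abG : abelian G.

(** The center of the quotient by the kernel of an irreducible character is cyclic, and here the
    quotient is abelian. *)
Lemma quotient_cfker_cyclic (i : Iirr G) : cyclic (G / cfker 'chi_i).
Proof.
have := cfcenter_cyclic 'chi_i.
by rewrite cfcenter_eq_center (center_idP _) // quotient_abelian.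
Qed.

(** For the converse, both characters are faithful on the same cyclic quotient and send a generator
    to primitive roots of unity of the same order, which a field automorphism exchanges. *)
Lemma galois_conj_cfker (i j : Iirr G) :
  galois_conj i j <-> cfker 'chi_j = cfker 'chi_i.
Proof.
split=> [[tau ->] | eq_ker]; first exact: cfker_aut.
have [lin_i lin_j] := (irr_lin abG i, irr_lin abG j).
have kerE k x : x \in G -> (x \in cfker 'chi[G]_k) = ('chi_k x == 1).
  by move=> Gx; rewrite cfkerEirr inE (lin_char1 (irr_lin abG k)).
have [gbar gen_gbar] := cyclicP (quotient_cfker_cyclic i).
have : gbar \in (G / cfker 'chi_i)%g by rewrite gen_gbar cycle_id.
case/morphimP=> g Ng Gg def_gbar.
(* Both conditions say that g^a lies in the common kernel; hence the two values have the same
   order. *)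
have eq1 a : ('chi_j g ^+ a == 1) = ('chi_i g ^+ a == 1).
  rewrite -(lin_charX lin_j) // -(lin_charX lin_i) //.
  by rewrite -!(kerE _ _ (groupX a Gg)) eq_ker.
have [m prim_i _] := prim_order_exists (order_gt0 g) (lin_char_unity_root lin_i Gg).
have [m' prim_j _] := prim_order_exists (order_gt0 g) (lin_char_unity_root lin_j Gg).
have def_m' : m' = m.
  apply/eqP; rewrite eqn_dvd (prim_order_dvd prim_j) (prim_order_dvd prim_i).
  by rewrite eq1 (prim_expr_order prim_i) eqxx -eq1 (prim_expr_order prim_j) eqxx.
rewrite def_m' in prim_j.
have [k def_k] := prim_rootP prim_i (prim_expr_order prim_j).
rewrite def_k (prim_root_exp_coprime _ prim_i) in prim_j.
(* [prim_j] now says that k is coprime to m, so raising m-th roots of unity to the power k extends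
   to an automorphism of [algC]. *)
have [tau tauE] := Qn_aut_exists prim_j.
exists tau; apply/cfun_inP=> x Gx; rewrite cfunE.
(* Writing x = y g^a with y in the kernel reduces the claim to the values at g. *)
have : coset (cfker 'chi_i) x \in (G / cfker 'chi_i)%g by rewrite mem_quotient.
have nKG := fintype.subsetP (normal_norm (cfker_normal 'chi_i)).
rewrite gen_gbar def_gbar => /cycleP[a]; rewrite -morphX //.
move/(rcoset_kercosetP (nKG x Gx) (nKG _ (groupX a Gg)))/rcosetP=> [y Ky ->].
have Gy : y \in G := fintype.subsetP (cfker_sub 'chi_i) y Ky.
rewrite !lin_charM ?lin_charX ?groupX // rmorphM rmorphXn /=.
rewrite (tauE _ (prim_expr_order prim_i)) -def_k; congr (_ * _).
have /eqP -> : 'chi_i y == 1 by rewrite -kerE.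
have /eqP -> : 'chi_j y == 1 by rewrite -kerE // eq_ker.
by rewrite rmorph1.
Qed.

(** Cauchy's theorem gives a subgroup of prime order in the nontrivial group L / K; H is its
    preimage. *)
Lemma prime_overgroup_exists (K L : {group gT}) :
  L \subset G -> K \subset L -> K :!=: L ->
  exists H : {group gT}, [/\ H \subset L, K \subset H & prime #|H : K|%g].
Proof.
move=> sLG sKL neqKL.
have nKL : (K <| L)%g by rewrite -sub_abelian_normal // (abelianS sLG).
have ntLK : (1 < #|(L / K)%g|)%N.
  rewrite cardG_gt1 -subG1 quotient_sub1 ?normal_norm //.
  by apply: contra neqKL => sLK; rewrite finset.eqEsubset sKL.
have [x LKx ox] := Cauchy (pdiv_prime ntLK) (pdiv_dvd _).
exists (coset K @*^-1 <[x]>)%G; split; rewrite ?sub_cosetpre //=.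
  by rewrite -(quotientGK nKL) morphpreS // cycle_subG.
rewrite -card_quotient ?normal_norm ?normal_cosetpre //.
by rewrite cosetpreK -orderE ox pdiv_prime.
Qed.

(** The cyclic group G / K has at most one subgroup of each order. *)
Lemma prime_overgroup_inj (i : Iirr G) (H H' : {group gT}) :
    H \subset G -> H' \subset G ->
    cfker 'chi_i \subset H -> cfker 'chi_i \subset H' ->
  #|H : cfker 'chi_i|%g = #|H' : cfker 'chi_i|%g -> H = H'.
Proof.
move=> sHG sHG' sKH sKH'.
have nK (L : {group gT}) : L \subset G -> cfker 'chi_i \subset L ->
    (cfker 'chi_i <| L)%g.
  by move=> sLG sKL; apply: normalS (cfker_normal _).
rewrite -!card_quotient ?normal_norm ?nK // => eq_card; apply/val_inj.
apply: (quotient_inj (nK _ sHG sKH) (nK _ sHG' sKH')); apply/eqP.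
by rewrite (eq_subG_cyclic (quotient_cfker_cyclic i)) ?quotientS ?eq_card.
Qed.

(** As H is abelian, its p-core S is its Sylow p-subgroup. If L contains K and S, then [H : H ∩ L]
    divides both p = [H : K] and the p'-number [H : S], so it is 1. *)
Lemma pcore_subset_prime_index (K H L : {group gT}) :
    H \subset G -> K \subset H -> prime #|H : K|%g -> K \subset L ->
  ('O_(#|H : K|%g)(H) \subset L)%g = (H \subset L).
Proof.
set p := #|H : K|%g => sHG sKH p_pr sKL.
apply/idP/idP=> [sSL | sHL]; last exact: fintype.subset_trans (pcore_sub _ _) sHL.
have : (p.-Sylow(H) 'O_p(H))%g.
  exact: nilpotent_pcore_Hall (abelian_nil (abelianS sHG abG)).
case/and3P=> sSH _ p'HS.
have sub_idx (M : {group gT}) : M \subset H -> M \subset L ->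
    (#|H : H :&: L|%g %| #|H : M|%g)%N.
  move=> sMH sML; have sM : M \subset H :&: L by rewrite finset.subsetI sMH.
  by rewrite -(Lagrange_index (finset.subsetIl H L) sM) dvdn_mulr.
have [idx1 | idx_neq1] := eqVneq #|H : H :&: L|%g 1%N.
  by move/eqP: idx1; rewrite indexg_eq1 finset.subsetI subxx.
have idx_p := prime_nt_dvdP p_pr idx_neq1 (sub_idx K sKH sKL).
by have := sub_idx _ sSH sSL; rewrite idx_p; move: p'HS; rewrite p'natE // => /negP.
Qed.

End CharacterKernel.

(** * The unit of the simple factor of W, determined by its character values *)

Section IsotypicalIdempotent.

Set Implicit Arguments.
Unset Strict Implicit.
Variables (gT : finGroupType) (G : {group gT}) (n : nat).
Variables (W : mx_representation rat G n) (i : Iirr G).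
Hypotheses (abG : abelian G) (irrW : mx_irreducible W).
Hypothesis assocW : galois_associated W i.

Local Notation R_G := (group_ring rat G).

(** The hypothesis of Maschke's theorem, automatic in characteristic 0. *)
Lemma rat_pchar'_group : (([pchar rat]%R)^').-group%g G.
Proof. by apply/pgroupP=> p _ _; rewrite inE /= Num.Theory.pchar_num. Qed.

Lemma isotypical_idem_group_ring : (isotypical_idem W \in R_G)%MS.
Proof.
by apply: submx_trans (Wedderburn_id_mem _) _; rewrite genmxE submxMl.
Qed.

Lemma isotypical_idemP : isotypical_idem W *m isotypical_idem W = isotypical_idem W.
Proof.
have [_ R_e ideR _] := Wedderburn_is_id_pchar rat_pchar'_group
  (irr_comp (rat_irr G) W).
exact: ideR.
Qed.

(** The units of the simple factors sum to 1, and all but that of W annihilate W. *)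
Lemma gring_op_isotypical_idem : gring_op W (isotypical_idem W) = 1%:M.
Proof.
rewrite -[RHS](gring_op1 W) -(Wedderburn_sum_id_pchar (rat_irr G) rat_pchar'_group).
rewrite linear_sum (bigD1 (irr_comp (rat_irr G) W)) //= big1 ?addr0 // => j neq.
exact: (irr_comp'_op0_pchar rat_pchar'_group irrW neq (Wedderburn_id_mem j)).
Qed.

(** The sum is the trace of 1 on W, that is, the dimension of W. *)
Lemma gchar_sum_neq0 : \sum_(j | `[< galois_conj i j >]) gchar j 1%:M != 0.
Proof.
rewrite -(ratr_trace_gring_op assocW (group_ring1 G)) gring_op1 mxtrace1.
rewrite ratr_nat Num.Theory.pnatr_eq0 -lt0n.
by case/mx_irrP: irrW.
Qed.

Lemma gchar_galois_conj j e : galois_conj i j -> gchar i e = 0 -> gchar j e = 0.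
Proof. by case=> tau def_j e0; rewrite (gchar_aut _ def_j) e0 rmorph0. Qed.

(** The value at ['chi_i] is 0 or 1. The value 0 would spread to all conjugates and give trace 0 on
    W, where the idempotent acts as the identity. *)
Lemma gchar_isotypical_idem_conj j :
  galois_conj i j -> gchar j (isotypical_idem W) = 1.
Proof.
move=> conj_ij; have Re := isotypical_idem_group_ring.
have [e0 | e1] := gchar_idem abG i Re isotypical_idemP; last first.
  by case: conj_ij => tau def_j; rewrite (gchar_aut _ def_j) e1 rmorph1.
case/eqP: gchar_sum_neq0.
rewrite -(ratr_trace_gring_op assocW (group_ring1 G)) gring_op1.
rewrite -gring_op_isotypical_idem (ratr_trace_gring_op assocW Re).
by apply: big1 => k /asboolP conj_ik; apply: gchar_galois_conj e0.
Qed.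

(* Schur's lemma makes e act on W as 0 or 1, and the trace excludes 0. *)
Lemma gring_op_eq1 e : (e \in R_G)%MS -> e *m e = e ->
  (forall j, galois_conj i j -> gchar j e = 1) -> gring_op W e = 1%:M.
Proof.
move=> Re ee gchar_e.
have opee : gring_op W e *m gring_op W e = gring_op W e.
  by rewrite -gring_opM // ee.
have nz_e : gring_op W e != 0.
  apply: contra_neq gchar_sum_neq0 => e0.
  transitivity (ratr (\tr (gring_op W e)) : algC); last by rewrite e0 mxtrace0 rmorph0.
  rewrite (ratr_trace_gring_op assocW Re); apply: eq_bigr => j /asboolP conj_ij.
  by rewrite gchar1 // gchar_e.
have cWe : centgmx W (gring_op W e).
  apply/centgmxP=> g Gg; rewrite -(gring_opG W Gg).
  have Rg : (regular_repr rat G g \in R_G)%MS by rewrite envelop_mx_id.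
  by rewrite -!gring_opM // (gringC abG).
have unit_e := mx_Schur irrW cWe nz_e.
by rewrite -[LHS]mul1mx -{1}(mulVmx unit_e) -mulmxA opee mulVmx.
Qed.

Lemma isotypical_idem_eq e : (e \in R_G)%MS ->
    (forall j, gchar j e = (cfker 'chi_j == cfker 'chi_i)%:R) ->
  isotypical_idem W = e.
Proof.
move=> Re gchar_e; set f := isotypical_idem W.
have Rf : (f \in R_G)%MS := isotypical_idem_group_ring.
have ee : e *m e = e.
  apply: (gchar_inj abG) => // [|j]; first exact: group_ring_mul.
  by rewrite (gcharM abG) // gchar_e; case: eqP => _; rewrite ?mulr1 ?mulr0.
have op_e : gring_op W e = 1%:M.
  apply: gring_op_eq1 => // j /(galois_conj_cfker abG) eq_ker.
  by rewrite gchar_e eq_ker eqxx.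
(* f e - f lies in the simple factor of W, which acts faithfully on W, and it acts there as 0
   because e acts as 1. *)
have fe : f *m e = f.
  apply/eqP; rewrite -subr_eq0 -mxvec_eq0 -submx0.
  rewrite -(ker_irr_comp_op_pchar (rat_irr G) rat_pchar'_group irrW) sub_capmx.
  apply/andP; split; last first.
    rewrite (sameP sub_kermxP eqP) mul_vec_lin mxvec_eq0 /= linearB /=.
    by rewrite gring_opM // op_e mulmx1 subrr.
  rewrite linearB /= addmx_sub ?eqmx_opp ?Wedderburn_id_mem //.
  have /andP[_ idr] := Wedderburn_ideal (irr_comp (rat_irr G) W).
  by apply: submx_trans idr; rewrite mem_mulsmx ?Wedderburn_id_mem.
apply: (gchar_inj abG) => // j; rewrite gchar_e.
case: eqP => [/(galois_conj_cfker abG) | /eqP/negPf neq_ker].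
  exact: gchar_isotypical_idem_conj.
by rewrite -fe (gcharM abG) // gchar_e neq_ker mulr0.
Qed.

End IsotypicalIdempotent.

(** * Factorization of the idempotent over the prime overgroups of K *)

Section PrimeOvergroups.

Set Implicit Arguments.
Unset Strict Implicit.
Variables (gT : finGroupType) (G : {group gT}) (i : Iirr G).
Hypothesis abG : abelian G.

Local Notation R_G := (group_ring rat G).
Local Notation K := (cfker_group 'chi_i).

(** Boolean form of [prime_overgroups], so that P_K can be enumerated. *)
Definition prime_over (H : {group gT}) : bool :=
  [&& H \subset G, K \subset H & prime #|H : K|%g].

Definition sylow_over (H : {group gT}) : {group gT} := 'O_(#|H : K|%g)(H)%G.

(* For H in P_K with [H : K] = p, p_H = p_K p_S where S is the Sylow p-subgroup
   of H. Trading H for S leaves a p-power as denominator of the second factor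
   of p_K - p_H = p_K (1 - p_S). *)
Definition sylow_compl (H : {group gT}) : 'M[rat]_#|G| :=
  1%:M - subgroup_idem G (sylow_over H).

Lemma sylow_over_sub H : prime_over H -> sylow_over H \subset G.
Proof. by case/and3P=> sHG _ _; apply: fintype.subset_trans (pcore_sub _ _) sHG. Qed.

Lemma sylow_compl_group_ring H : prime_over H -> (sylow_compl H \in R_G)%MS.
Proof.
move=> PH; apply: group_ringB; first exact: group_ring1.
exact/subgroup_idem_group_ring/sylow_over_sub.
Qed.

Lemma gchar_sylow_compl j H : prime_over H -> K \subset cfker 'chi_j ->
  gchar j (sylow_compl H) = (~~ (H \subset cfker 'chi_j))%:R.
Proof.
move=> PH sKj; have [sHG sKH p_pr] := and3P PH.
rewrite gcharB (gchar1 abG) (gchar_subgroup_idem abG) ?sylow_over_sub //.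
rewrite (@pcore_subset_prime_index _ _ abG K H (cfker_group 'chi_j)) //=.
by case: (H \subset _); rewrite ?subrr ?subr0.
Qed.

Lemma sylow_complP H : prime_over H -> sylow_compl H *m sylow_compl H = sylow_compl H.
Proof.
move=> PH; have Ru := sylow_compl_group_ring PH.
apply: (gchar_inj abG) => // [|j]; first exact: group_ring_mul.
rewrite (gcharM abG) // gcharB (gchar1 abG).
rewrite (gchar_subgroup_idem abG) ?sylow_over_sub //.
by case: (_ \subset _); rewrite ?subrr ?subr0 ?mulr0 ?mulr1.
Qed.

(** Compared character by character: if K lies in the kernel, H and its Sylow subgroup lie there
    together; if not, both sides vanish. *)
Lemma subgroup_idem_prime_over H : prime_over H ->
  subgroup_idem G K - subgroup_idem G H = subgroup_idem G K *m sylow_compl H.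
Proof.
move=> PH; have [sHG sKH _] := and3P PH; have Ru := sylow_compl_group_ring PH.
have sKG := cfker_sub 'chi_i.
have [RK RH] := (subgroup_idem_group_ring sKG, subgroup_idem_group_ring sHG).
apply: (gchar_inj abG) => [||j]; [exact: group_ringB | exact: group_ring_mul |].
rewrite gcharB (gcharM abG) // !(gchar_subgroup_idem abG) //.
have [sKj | nsKj] := boolP (K \subset cfker 'chi_j).
  rewrite gchar_sylow_compl // mul1r.
  by case: (H \subset cfker 'chi_j); rewrite ?subrr ?subr0.
have /negPf -> : ~~ (H \subset cfker 'chi_j).
  by apply: contra nsKj; apply: fintype.subset_trans.
by rewrite mul0r subrr.
Qed.

Lemma gintegral_subgroup_idem (H : {group gT}) : H \subset G ->
  gintegral (#|H|%:R *: subgroup_idem G H).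
Proof.
move=> sHG; rewrite scalerA divff ?scale1r; first exact: gintegral_gset.
by rewrite Num.Theory.pnatr_eq0 -lt0n.
Qed.

Lemma gintegral_sylow_compl H : prime_over H ->
  gintegral (#|sylow_over H|%:R *: sylow_compl H).
Proof.
move=> PH; rewrite scalerBr; apply: gintegralB.
  exact/gintegralMn/gintegral1.
exact/gintegral_subgroup_idem/sylow_over_sub.
Qed.

(** Distinct members of P_K have distinct prime indices over K, so the two orders are powers of
    different primes. *)
Lemma sylow_over_coprime H H' : prime_over H -> prime_over H' -> H != H' ->
  coprime #|sylow_over H| #|sylow_over H'|.
Proof.
move=> /and3P[sHG sKH p_pr] /and3P[sHG' sKH' p_pr'] neqHH'.
apply: (pnat_coprime (pcore_pgroup _ _)).
apply: (pi_pnat (pcore_pgroup _ _)); rewrite !inE.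
apply: contra neqHH' => /eqP eq_p; apply/eqP.
exact: (prime_overgroup_inj abG sHG sHG' sKH sKH').
Qed.

Lemma sylow_over_coprime_prod H s :
    prime_over H -> all prime_over s -> H \notin s ->
  coprime #|sylow_over H| (\prod_(H' <- s) #|sylow_over H'|)%N.
Proof.
move=> PH; elim: s => [|H' s IHs] /=; first by rewrite big_nil coprimen1.
case/andP=> PH' Ps; rewrite inE negb_or => /andP[neqHH' H's].
by rewrite big_cons coprimeMr sylow_over_coprime // IHs.
Qed.

(** Taken over a sequence for induction; the order is immaterial for members of P_K, whose factors
    commute. *)
Definition sylow_compl_prod (s : seq {group gT}) : 'M[rat]_#|G| :=
  \big[mulmx/1%:M]_(H <- s) sylow_compl H.

Lemma sylow_compl_prod_cons H s :
  sylow_compl_prod (H :: s) = sylow_compl H *m sylow_compl_prod s.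
Proof. by rewrite /sylow_compl_prod big_cons. Qed.

Lemma sylow_compl_prod_group_ring s :
  all prime_over s -> (sylow_compl_prod s \in R_G)%MS.
Proof.
elim: s => [_ | H s IHs /= /andP[PH Ps]].
  by rewrite /sylow_compl_prod big_nil group_ring1.
rewrite sylow_compl_prod_cons group_ring_mul ?IHs //.
exact: sylow_compl_group_ring.
Qed.

Lemma sylow_compl_prodP s : all prime_over s ->
  sylow_compl_prod s *m sylow_compl_prod s = sylow_compl_prod s.
Proof.
elim: s => [_ | H s IHs /= /andP[PH Ps]].
  by rewrite /sylow_compl_prod big_nil mulmx1.
have [Ru Rs] := (sylow_compl_group_ring PH, sylow_compl_prod_group_ring Ps).
rewrite sylow_compl_prod_cons mulmxA -(mulmxA _ _ (sylow_compl H)).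
by rewrite (gringC abG Rs Ru) mulmxA sylow_complP // -mulmxA IHs.
Qed.

Lemma gintegral_sylow_compl_prod s : all prime_over s ->
  gintegral ((\prod_(H <- s) #|sylow_over H|)%N%:R *: sylow_compl_prod s).
Proof.
elim: s => [_ | H s IHs /= /andP[PH Ps]].
  by rewrite big_nil /sylow_compl_prod big_nil; apply/gintegralMn/gintegral1.
rewrite big_cons sylow_compl_prod_cons natrM -scalerA scalemxAr scalemxAl.
by apply: gintegralM; [exact: gintegral_sylow_compl | exact: IHs].
Qed.

Lemma gchar_sylow_compl_prod j s : all prime_over s -> K \subset cfker 'chi_j ->
  gchar j (sylow_compl_prod s)
    = (all (fun H : {group gT} => ~~ (H \subset cfker 'chi_j)) s)%:R.
Proof.
move=> + sKj; elim: s => [_ | H s IHs /= /andP[PH Ps]].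
  by rewrite /sylow_compl_prod big_nil gchar1.
rewrite sylow_compl_prod_cons (gcharM abG) ?sylow_compl_group_ring //; last first.
  exact: sylow_compl_prod_group_ring.
by rewrite gchar_sylow_compl // IHs // -natrM mulnb.
Qed.

Lemma gchar_isotypical j s : s =i prime_over ->
  gchar j (subgroup_idem G K *m sylow_compl_prod s)
    = (cfker 'chi_j == cfker 'chi_i)%:R.
Proof.
move=> def_s; have Ps : all prime_over s by apply/allP=> H; rewrite def_s.
have sKG := cfker_sub 'chi_i; have Rs := sylow_compl_prod_group_ring Ps.
rewrite (gcharM abG) ?subgroup_idem_group_ring // (gchar_subgroup_idem abG) //.
have [sKj | nsKj] := boolP (K \subset cfker 'chi_j); last first.
  by rewrite mul0r; case: eqP nsKj => // ->; rewrite subxx.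
rewrite gchar_sylow_compl_prod // mul1r; congr (nat_of_bool _)%:R.
(* A kernel strictly larger than K would contain a member of P_K, while K itself contains none. *)
apply/allP/eqP=> [no_over | -> H].
  apply/eqP; apply: contraT => neq_ker.
  have [|H [sHj sKH p_pr]] := prime_overgroup_exists abG (cfker_sub 'chi_j) sKj.
    by rewrite eq_sym.
  have := no_over H; rewrite def_s sHj /= => -> //.
  by apply/and3P; split=> //; apply: fintype.subset_trans sHj (cfker_sub _).
rewrite def_s => /and3P[_ sKH p_pr]; apply: contraL p_pr => sHK.
by have /eqP -> : #|H : K|%g == 1%N by rewrite indexg_eq1.
Qed.

Variables (R : realType) (A : abelian_variety R) (act : gT -> A -> A).
Hypothesis actG : acts_by_automorphisms G act.

(** Induction splitting off one factor at a time. The sequence is nonempty because the empty product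
    gives A^K, whereas the empty intersection is all of A. *)
Lemma eim_sylow_compl_prod H s : uniq (H :: s) -> all prime_over (H :: s) ->
  eim act (subgroup_idem G K *m sylow_compl_prod (H :: s))
    = (\bigcap_(H' in [set` H :: s]) av_compl G act K H')%classic.
Proof.
have sKG := cfker_sub 'chi_i.
elim: s H => [|H1 s IHs] H Us Ps.
  move: Ps => /= /andP[PH _]; rewrite set_cons1 bigcap_set1.
  rewrite /av_compl subgroup_idem_prime_over //.
  by rewrite sylow_compl_prod_cons /sylow_compl_prod big_nil mulmx1.
have /andP[Hs Us'] : (H \notin H1 :: s) && uniq (H1 :: s) := Us.
have /andP[PH Ps'] : prime_over H && all prime_over (H1 :: s) := Ps.
have prod_gt0 : (0 < \prod_(H' <- H1 :: s) #|sylow_over H'|)%N.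
  by apply: prodn_gt0 => H'.
rewrite sylow_compl_prod_cons mulmxA.
(* Here q = p_K, e is the factor of H and e' the product of the others; their denominators are |S|
   and the product of the other Sylow orders. *)
rewrite (eim_inter abG actG (cardG_gt0 K) (cardG_gt0 _) prod_gt0
  (sylow_over_coprime_prod PH Ps' Hs) (sylow_complP PH) (sylow_compl_prodP Ps')
  (gintegral_subgroup_idem sKG) (gintegral_sylow_compl PH)
  (gintegral_sylow_compl_prod Ps')).
rewrite IHs // -subgroup_idem_prime_over //.
have -> : [set` [:: H, H1 & s]]%classic = (H |` [set` H1 :: s])%classic.
  by apply/seteqP; split=> H' /predU1P.
by rewrite bigcap_setU1.
Qed.

End PrimeOvergroups.

(** * The isotypical component as an intersection of complements *)

Theorem theorem5p1 (R : realType) (A : abelian_variety R)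
    (gT : finGroupType) (G : {group gT}) (act : gT -> A -> A)
    (n : nat) (W : mx_representation rat G n) (i : Iirr G) :
  abelian G ->
  acts_by_automorphisms G act ->
  acts_faithfully G act ->
  mx_irreducible W ->
  galois_associated W i ->
  let K := cfker_group 'chi_i in
  isotypical_component act W =
    if K == G then av_fix G act G
    else (\bigcap_(H in prime_overgroups G K) av_compl G act K H)%classic.
Proof.
move=> abG actG _ irrW assocW K; rewrite /isotypical_component.
have sKG : K \subset G := cfker_sub 'chi_i.
pose s := enum [pred H | prime_over i H].
have def_s : s =i prime_over i by move=> H; rewrite mem_enum.
have Ps : all (prime_over i) s by apply/allP=> H; rewrite def_s.
have RK : (subgroup_idem G K *m sylow_compl_prod i s \in group_ring rat G)%MS.
  by rewrite group_ring_mul ?subgroup_idem_group_ring ?sylow_compl_prod_group_ring.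
rewrite (isotypical_idem_eq abG irrW assocW RK) => [|j]; last exact: gchar_isotypical.
case: eqP => [eqKG | /eqP neqKG].
  (* For K = G the set P_K is empty, so only the factor p_G remains. *)
  have -> : s = [::].
    apply/eqP; rewrite -size_eq0 -leqn0 leqNgt -has_predT; apply/hasPn=> H.
    rewrite def_s => /and3P[sHG _]; rewrite -[cfker_group _]/K eqKG.
    by have /eqP -> : #|H : G|%g == 1%N by rewrite indexg_eq1.
  by rewrite /sylow_compl_prod big_nil mulmx1 eqKG.
(* For K ≠ G the set P_K is nonempty, as the intersection formula requires. *)
have [H [sHG sKH p_pr]] := prime_overgroup_exists abG (subxx G) sKG neqKG.
have: H \in s by rewrite def_s; apply/and3P.
have: uniq s by apply: enum_uniq.
case def: s Ps => [//|H0 s0] Ps Us _.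
rewrite (eim_sylow_compl_prod abG actG Us Ps); congr (bigcap _ _).
apply/seteqP; split=> H1 /=; rewrite -def def_s; first by case/and3P.
by case=> *; apply/and3P.
Qed.
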